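(* Let $p\ge 1$ be an integer. The variety $\mathfrak{G}_1\subset\Bbbk^{9p}$ for $Y_p(\mathfrak{gl}_3)$ (the weak version of the Gelfand-Tsetlin variety) is equidimensional of dimension $\dim\mathfrak{G}_1=3p$.
   Context: $\Bbbk$ is an algebraically closed field of characteristic zero. A variety is the zero set $V(S)$ in affine space of a set $S$ of polynomials; it is equidimensional if all its irreducible components have the same dimension. Coordinates on $\Bbbk^{9p}$ are $X_{ij}^{(k)}$, $1\le i,j\le 3$, $1\le k\le p$ (these are the generators of the associated graded algebra of the restricted Yangian $Y_p(\mathfrak{gl}_3)$ of level $p$). Polynomials $p_{ij}$: $p_{1j}=X_{11}^{(j)}$ for $1\le j\le p$. $p_{2j}=X_{22}^{(j)}-\sum_{t=1}^{j-1}X_{12}^{(t)}X_{21}^{(j-t)}$ for $1\le j\le p$ (so $p_{21}=X_{22}^{(1)}$), and $p_{2,p+j}=\sum_{t=j}^{p}X_{12}^{(t)}X_{21}^{(p+j-t)}$ for $1\le j\le p$. For $1\le j\le 3p$, $$p_{3j}=\epsilon_j-\sum_{\substack{s+t=j\\1\le s,t\le p}}\left(X_{13}^{(s)}X_{31}^{(t)}+X_{23}^{(s)}X_{32}^{(t)}\right)+\sum_{\substack{r+s+t=j\\1\le r,s,t\le p}}\left(X_{12}^{(r)}X_{23}^{(s)}X_{31}^{(t)}+X_{13}^{(r)}X_{21}^{(s)}X_{32}^{(t)}\right)-\sum_{\substack{r+s+t=j\\1\le r,s,t\le p}}X_{13}^{(r)}X_{22}^{(s)}X_{31}^{(t)},$$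 where $\epsilon_j=X_{33}^{(j)}$ if $j\le p$ and $\epsilon_j=0$ if $j>p$, and where in the last sum the terms with $s=1$ are omitted when $j\le p+1$. The variety is $$\mathfrak{G}_1:=V\left(\{p_{ij}\}_{i=1,2;\ 1\le j\le p}\cup\{X_{12}^{(i)}\}_{i=1}^{p}\cup\{p_{3j}\}_{1\le j\le 3p}\right)\subset\Bbbk^{9p}.$$ *)

(* Defs.v *)
From mathcomp Require Import all_boot all_algebra.
From mathcomp Require Import classical_sets.
From mathcomp Require Import mpoly.

Set Implicit Arguments.
Unset Strict Implicit.
Unset Printing Implicit Defensive.

Import GRing.Theory.
Local Open Scope ring_scope.
Local Open Scope classical_set_scope.

Section AffineVarieties.
Variables (K : closedFieldType) (n : nat).

Definition zero_locus (S : set {mpoly K[n]}) : set 'rV[K]_n :=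
  [set x | forall f, S f -> f.@[x ord0] = 0].

Definition zariski_closed (A : set 'rV[K]_n) : Prop :=
  exists S : set {mpoly K[n]}, A = zero_locus S.

Definition irreducible_closed (A : set 'rV[K]_n) : Prop :=
  [/\ zariski_closed A, A !=set0 &
      forall B C : set 'rV[K]_n, zariski_closed B -> zariski_closed C ->
        A `<=` B `|` C -> A `<=` B \/ A `<=` C].

Definition irreducible_component (A Z : set 'rV[K]_n) : Prop :=
  [/\ irreducible_closed Z, Z `<=` A &
      forall W, irreducible_closed W -> W `<=` A -> Z `<=` W -> W = Z].

(* A chain Z 0, ..., Z d (only the first d + 1 values of Z are used). *)
Definition irreducible_chain (A : set 'rV[K]_n) (d : nat)
    (Z : nat -> set 'rV[K]_n) : Prop :=
  (forall i, (i <= d)%N -> irreducible_closed (Z i) /\ Z i `<=` A) /\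
  (forall i, (i < d)%N -> Z i `<` Z i.+1).

(* Krull dimension, as a relation; the empty set has no dimension. *)
Definition has_dim (A : set 'rV[K]_n) (d : nat) : Prop :=
  (exists Z, irreducible_chain A d Z) /\
  (forall e Z, irreducible_chain A e Z -> (e <= d)%N).

Definition equidimensional (A : set 'rV[K]_n) : Prop :=
  exists d, forall Z, irreducible_component A Z -> has_dim Z d.

End AffineVarieties.

Section GelfandTsetlin.
Variables (K : closedFieldType) (p : nat).

(* X i j k is X_{ij}^{(k)}, with the 1-based indices 1 <= i, j <= 3 and
   1 <= k <= p; these triples biject with 'I_(9 * p).  The default value 0 and
   the other triples (i, j, k) are never used below. *)
Definition X (i j k : nat) : {mpoly K[9 * p]} :=
  if insub ((i.-1 * 3 + j.-1) * p + k.-1)%N is Some l then 'X_l else 0.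

(* p_{1j} and p_{2j} are meant for 1 <= j <= p, and p_{3j} for
   1 <= j <= 3p. *)
Definition p1 (j : nat) : {mpoly K[9 * p]} := X 1 1 j.

Definition p2 (j : nat) : {mpoly K[9 * p]} :=
  X 2 2 j - \sum_(1 <= t < j) X 1 2 t * X 2 1 (j - t).

Definition eps (j : nat) : {mpoly K[9 * p]} :=
  if (j <= p)%N then X 3 3 j else 0.

Definition p3 (j : nat) : {mpoly K[9 * p]} :=
  eps j
  - \sum_(1 <= s < p.+1) \sum_(1 <= t < p.+1 | (s + t == j)%N)
      (X 1 3 s * X 3 1 t + X 2 3 s * X 3 2 t)
  + \sum_(1 <= r < p.+1) \sum_(1 <= s < p.+1)
      \sum_(1 <= t < p.+1 | (r + s + t == j)%N)
      (X 1 2 r * X 2 3 s * X 3 1 t + X 1 3 r * X 2 1 s * X 3 2 t)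
  - \sum_(1 <= r < p.+1) \sum_(1 <= s < p.+1)
      \sum_(1 <= t < p.+1 | (r + s + t == j)%N
                            && ~~ ((s == 1)%N && (j <= p.+1)%N))
      X 1 3 r * X 2 2 s * X 3 1 t.

Definition G1_equations : set {mpoly K[9 * p]} :=
  [set f | exists2 j, (1 <= j <= p)%N & [\/ f = p1 j, f = p2 j | f = X 1 2 j]]
  `|` [set f | exists2 j, (1 <= j <= 3 * p)%N & f = p3 j].

Definition G1 : set 'rV[K]_(9 * p) := zero_locus G1_equations.

End GelfandTsetlin.

Arguments G1 K p : clear implicits.

(* Main.v *)
(** Write a, b, c, d, e for the generating polynomials (divisible by z, of degree
    at most p) of X13, X31, X23, X32, X21. On G1 the coordinates X11, X12, X22
    vanish, X33 is determined by the others, and what remains is the condition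
    that ab + cd - aed has degree at most p. This is symmetric under a <-> d,
    b <-> c, so assume deg a <= deg d; comparing degrees then forces a = 0,
    e = 0 or deg a + deg e <= p. Hence G1 is the union of strata on which
    deg a <= m, deg e <= p - m, deg d = l with m <= l. On a stratum the
    coefficients of b, those of a, d and e, and the p - l lower ones of c
    (3p in total) are free, and Euclidean division by z^(p-l+1) d determines
    the rest of c; so the stratum is the graph of a map which is regular where
    the leading coefficient of d is invertible. Its closure is therefore
    irreducible of dimension 3p.

    For the Krull dimension of such a graph S over an open subset of d-space:
    flags of affine subspaces give a chain of length d. Given a chain of length
    d + 1, functions f_i vanishing on its i-th term but not on the next are
    algebraically independent on the top one, which contradicts a count of
    monomials, as the f_i restrict on S to fractions in d variables. *)

Require Import Defs.
From mathcomp Require Import all_boot all_algebra.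
From mathcomp Require Import boolp classical_sets.
From mathcomp Require Import mpoly zify ring.

Set Implicit Arguments.
Unset Strict Implicit.
Unset Printing Implicit Defensive.

Import GRing.Theory.

(** * Zariski closures and chains *)

Section ZariskiClosure.
Local Open Scope ring_scope.
Local Open Scope classical_set_scope.
Variables (K : closedFieldType) (n : nat).
Implicit Types (A B W : set 'rV[K]_n) (f g : {mpoly K[n]}).

Definition vanishing A : set {mpoly K[n]} :=
  [set f | forall x, A x -> f.@[x ord0] = 0].

Definition zariski_closure A := zero_locus (vanishing A).

Lemma sub_zariski_closure A : A `<=` zariski_closure A.
Proof. by move=> x Ax f; apply. Qed.

Lemma zariski_closed_closure A : zariski_closed (zariski_closure A).
Proof. by exists (vanishing A). Qed.

Lemma zariski_closure_sub A B :
  zariski_closed B -> A `<=` B -> zariski_closure A `<=` B.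
Proof.
by move=> [T ->] sAB x Ax f Tf; apply: Ax => y /sAB; apply.
Qed.

Lemma zariski_closed_separated B x : zariski_closed B -> ~ B x ->
  exists2 f, vanishing B f & f.@[x ord0] != 0.
Proof.
move=> [T ->] nTx.
have [f /not_implyP[Tf /eqP fx]] : exists f, ~ (T f -> f.@[x ord0] = 0).
  by apply/existsNP => H; apply: nTx.
by exists f => // y; apply.
Qed.

(** The zero loci of [f] and [g] cover [W], so one of them contains it: the vanishing ideal of [W]
    is prime. *)
Lemma irreducible_mul W f g : irreducible_closed W ->
  vanishing W (f * g) -> vanishing W f \/ vanishing W g.
Proof.
move=> [_ _ irrW] fg0.
have closed1 (q : {mpoly K[n]}) : zariski_closed (zero_locus [set q]).
  by exists [set q].
have [|sub|sub] := irrW _ _ (closed1 f) (closed1 g).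
- move=> x /fg0 /eqP; rewrite mevalM mulf_eq0 => /orP[]/eqP qx.
    by left=> _ ->.
  by right=> _ ->.
- by left=> x /sub; apply.
- by right=> x /sub; apply.
Qed.

Lemma irreducible_cover (I : eqType) (s : seq I) (Z : I -> set 'rV[K]_n) W :
    irreducible_closed W -> (forall i, zariski_closed (Z i)) ->
    (forall x, W x -> exists2 i, i \in s & Z i x) ->
  exists2 i, i \in s & W `<=` Z i.
Proof.
move=> irrW clZ covW.
(* Stronger claim for the induction on [s]: only the part of [W] where [f] is nonzero has to be
   covered. If [W] is not inside [Z i], replacing [f] by [f * g] with [g] vanishing on [Z i]
   discards [Z i], and by primality [f * g] does not vanish on [W]. *)
suff: forall f, ~ vanishing W f ->
    (forall x, W x -> f.@[x ord0] != 0 -> exists2 i, i \in s & Z i x) ->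
  exists2 i, i \in s & W `<=` Z i.
  move=> /(_ 1); apply=> [W0|x Wx _]; last exact: covW.
  have [_ [x Wx] _] := irrW.
  by move/eqP: (W0 x Wx); rewrite meval1 oner_eq0.
elim: s {covW} => [|i s IHs] f nf covW.
  case: nf => x Wx; have [//|fx] := eqVneq (f.@[x ord0]) 0.
  by have [] := covW x Wx fx.
have [?|/existsNP[x /not_implyP[Wx nZx]]] := pselect (W `<=` Z i).
  by exists i; rewrite ?mem_head.
have [g gZ gx] := zariski_closed_separated (clZ i) nZx.
have [||j js WZj] := IHs (f * g).
- move=> /(irreducible_mul irrW)[//|/(_ x Wx)/eqP].
  by rewrite (negPf gx).
- move=> y Wy; rewrite mevalM mulf_eq0 negb_or => /andP[fy gy].
  have [j] := covW y Wy fy; rewrite inE => /predU1P[->|js Zy]; last by exists j.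
  by move=> /gZ/eqP; rewrite (negPf gy).
- by exists j => //; rewrite inE js orbT.
Qed.

Definition linearly_independent_on W (T : finType) (u : T -> {mpoly K[n]}) :=
  forall c : T -> K,
    (forall x, W x -> \sum_t c t * (u t).@[x ord0] = 0) -> forall t, c t = 0.

Section AddFunction.
Variables (W W' : set 'rV[K]_n) (f : {mpoly K[n]}).
Variables (T : finType) (u : T -> {mpoly K[n]}).
Hypotheses (irrW' : irreducible_closed W') (sWW' : W `<=` W').
Hypotheses (fW : vanishing W f) (fW' : ~ vanishing W' f).
Hypothesis uW : linearly_independent_on W u.

(** On [W] only the constant term in [f] survives, so its coefficients vanish by [uW]. The rest is
    [f] times a shorter expansion, and [f] cancels because the vanishing ideal of [W'] is prime. *)
Lemma vanishing_expansion s (c : T -> nat -> K) :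
    (forall x, W' x ->
       \sum_(j < s) (\sum_t c t j * (u t).@[x ord0]) * f.@[x ord0] ^+ j = 0) ->
  forall t j, (j < s)%N -> c t j = 0.
Proof.
elim: s c => // s IHs c c0.
have ct0 : forall t, c t 0%N = 0.
  apply: uW => x Wx; have := c0 _ (sWW' Wx).
  rewrite big_ord_recl expr0 mulr1 [X in _ + X]big1 ?addr0 // => j _.
  by rewrite fW // expr0n mulr0.
move=> t [|j]; first by rewrite ct0.
rewrite ltnS; apply: (IHs (fun t j => c t j.+1)) => x Wx.
pose q := \sum_(j < s) (\sum_t c t j.+1 *: u t) * f ^+ j.
have qE y : q.@[y ord0] =
    \sum_(j < s) (\sum_t c t j.+1 * (u t).@[y ord0]) * f.@[y ord0] ^+ j.
  rewrite raddf_sum; apply: eq_bigr => i _.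
  rewrite /= mevalM rmorphXn raddf_sum; congr (_ * _).
  by apply: eq_bigr => k _; rewrite /= mevalZ.
rewrite -qE; have [|//|] := irreducible_mul (f := f) (g := q) irrW'; last exact.
move=> y Wy; rewrite mevalM qE -[RHS](c0 _ Wy) big_ord_recl.
rewrite [X in X * _ + _]big1 ?mul0r ?add0r => [|k _]; last by rewrite ct0 mul0r.
rewrite mulr_sumr; apply: eq_bigr => i _.
by rewrite mulrCA -exprS.
Qed.

Lemma linearly_independent_powers s :
  linearly_independent_on W'
    (fun tj : T * 'I_s => u tj.1 * f ^+ (tj.2 : nat)).
Proof.
move=> c c0 [t j].
pose c' t j := if insub j is Some i then c (t, i) else 0.
have c'E t' (j' : 'I_s) : c' t' j' = c (t', j').
  by rewrite /c' insubT //= => ltj; congr (c (_, _)); apply: val_inj.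
rewrite -c'E; apply: vanishing_expansion (ltn_ord j) => x Wx.
have : \sum_t \sum_(j < s) c (t, j) * (u t * f ^+ j).@[x ord0] = 0.
  by rewrite -[RHS](c0 _ Wx) pair_bigA; apply: eq_bigr => -[].
rewrite exchange_big /= => c0x; apply: etrans c0x.
apply: eq_bigr => i _; rewrite mulr_suml; apply: eq_bigr => k _.
by rewrite c'E mevalM rmorphXn mulrA.
Qed.

End AddFunction.

(* If [f i] vanishes on [Z i] but not on [Z i.+1], the monomials in the [f i]
   are independent on the top of the chain; [wt] is a filtration recording
   their degrees. *)
Lemma chain_independent (A : set 'rV[K]_n) e Z (f : nat -> {mpoly K[n]})
    (wt : nat -> {mpoly K[n]} -> Prop) D s :
    irreducible_chain A e Z ->
    (forall i, (i < e)%N -> vanishing (Z i) (f i) /\ ~ vanishing (Z i.+1) (f i)) ->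
    wt 0%N 1 -> (forall a b g h, wt a g -> wt b h -> wt (a + b)%N (g * h)) ->
    (forall a b g, (a <= b)%N -> wt a g -> wt b g) ->
    (forall i, (i < e)%N -> wt D (f i)) ->
  exists (T : finType) (u : T -> {mpoly K[n]}),
    [/\ #|T| = (s ^ e)%N, linearly_independent_on (Z e) u &
        forall t, wt (D * s * e)%N (u t)].
Proof.
move=> chZ fZ wt1 wtM wtW wtf.
have wtX i k : (i < e)%N -> wt (D * k)%N (f i ^+ k).
  move=> lti; elim: k => [|k IHk]; first by rewrite muln0.
  by rewrite exprS mulnS; apply: wtM => //; apply: wtf.
elim: e chZ fZ {wtf} wtX => [|e IHe] [irrZ subZ] fZ wtX.
  exists unit, (fun=> 1); split=> [|c c0 []|_].
  - by rewrite card_unit.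
  - have [[_ [x Zx] _] _] := irrZ 0%N (leqnn _).
    by have := c0 x Zx; rewrite (big_pred1 tt) ?meval1 ?mulr1 // => -[].
  - by rewrite muln0.
have [|i lti|i k lti|T [u [cardT uZ wtu]]] := IHe.
- split=> i lei; first by apply: irrZ; apply: leqW.
  by apply: subZ; apply: ltnW.
- by apply: fZ; apply: ltnW.
- by apply: wtX; apply: ltnW.
exists (T * 'I_s)%type, (fun tj : T * 'I_s => u tj.1 * f e ^+ (tj.2 : nat)); split.
- by rewrite card_prod cardT card_ord expnSr.
- have [f0 f1] := fZ e (leqnn _).
  apply: (linearly_independent_powers _ _ f0 f1 uZ); first exact: (irrZ _ _).1.
  by have [] := subZ e (leqnn _).
- move=> [t j] /=; rewrite mulnS addnC; apply: wtM => //.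
  apply: wtW (wtX _ _ (leqnn _)).
  by rewrite leq_mul2l (ltnW (ltn_ord j)) orbT.
Qed.

Lemma chain_functions (A : set 'rV[K]_n) e Z : irreducible_chain A e Z ->
  exists f : nat -> {mpoly K[n]}, forall i, (i < e)%N ->
    vanishing (Z i) (f i) /\ ~ vanishing (Z i.+1) (f i).
Proof.
move=> [irrZ subZ].
suff /choice[f fP] : forall i, exists f, (i < e)%N ->
    vanishing (Z i) f /\ ~ vanishing (Z i.+1) f by exists f.
move=> i; have [lti|] := boolP (i < e)%N; last by exists 0.
have [[clZ _ _] _] := irrZ i (ltnW lti).
have [sub /existsNP[x /not_implyP[Zx nZx]]] := subZ i lti.
have [f fZ fx] := zariski_closed_separated clZ nZx.
by exists f => _; split=> // /(_ x Zx)/eqP; rewrite (negPf fx).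
Qed.

(** The terms increase up to index [e], so all of them lie in [Z e]. *)
Lemma irreducible_chain_sub A B e Z :
  irreducible_chain A e Z -> Z e `<=` B -> irreducible_chain B e Z.
Proof.
move=> [irrZ subZ] ZeB; split=> // i lei; split; first exact: (irrZ i lei).1.
have sub_step k : (i + k <= e)%N -> Z i `<=` Z (i + k)%N.
  elim: k => [|k IHk]; first by rewrite addn0 => _ x.
  rewrite addnS => ltk x Zx; have [sub _] := subZ _ ltk.
  by apply: sub; apply: IHk Zx; apply: ltnW.
have := sub_step (e - i)%N; rewrite subnKC // => /(_ (leqnn _)) sub.
by move=> x /sub /ZeB.
Qed.

(** By irreducibility a component, or the top term of a chain, lies in a single [Z i]. Maximality
    makes the component equal to [Z i], and the dimension of [Z i] bounds the chain; [Z i0] provides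
    a chain of length [d]. *)
Lemma equidimensional_cover (A : set 'rV[K]_n) (I : eqType) (i0 : I) (s : seq I)
    (Z : I -> set 'rV[K]_n) d :
    i0 \in s -> (forall i, zariski_closed (Z i)) ->
    (forall i, i \in s ->
       [/\ irreducible_closed (Z i), Z i `<=` A & has_dim (Z i) d]) ->
    (forall x, A x -> exists2 i, i \in s & Z i x) ->
  equidimensional A /\ has_dim A d.
Proof.
move=> s0 clZ sZ covA.
have cover W : irreducible_closed W -> W `<=` A ->
    exists2 i, i \in s & W `<=` Z i.
  by move=> irrW WA; apply: irreducible_cover => // x /WA /covA.
split.
  exists d => W [irrW WA maxW]; have [i si WZ] := cover W irrW WA.
  by have [irrZ ZA dimZ] := sZ i si; rewrite -(maxW _ irrZ ZA WZ).
split.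
  have [_ ZA [[W [irrW subW]] _]] := sZ i0 s0.
  exists W; apply: irreducible_chain_sub (conj irrW subW) _.
  exact: subset_trans (irrW d (leqnn _)).2 ZA.
move=> e W chW; have [irrW WA] := chW.1 e (leqnn _).
have [i si WZ] := cover _ irrW WA; have [_ _ [_ ub]] := sZ i si.
exact: ub (irreducible_chain_sub chW WZ).
Qed.

End ZariskiClosure.

(** * Polynomials in [d] variables: degrees, restriction to lines, counting monomials *)

Section MultivariatePolynomials.
Local Open Scope ring_scope.
Variables (K : closedFieldType) (d : nat).
Implicit Types (F G : {mpoly K[d]}) (u v : 'I_d -> K).

Lemma msizeM_leq F G a b : (msize F <= a.+1)%N -> (msize G <= b.+1)%N ->
  (msize (F * G) <= (a + b).+1)%N.
Proof.
have [->|F0] := eqVneq F 0; first by rewrite mul0r msize0.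
have [->|G0] := eqVneq G 0; first by rewrite mulr0 msize0.
move=> Fa Gb; rewrite msizeM // -subn1 leq_subLR add1n -addnS -addSn.
exact: leq_add.
Qed.

Lemma msizeX_leq F a k :
  (msize F <= a.+1)%N -> (msize (F ^+ k) <= (a * k).+1)%N.
Proof.
move=> Fa; elim: k => [|k IHk]; first by rewrite expr0 msize1.
by rewrite exprS mulnS msizeM_leq.
Qed.

Lemma meval_line F u v : exists q : {poly K},
  forall t, q.[t] = F.@[fun k => u k + t * (v k - u k)].
Proof.
pose line k : {poly K} := (u k)%:P + 'X * (v k - u k)%:P.
exists (mmap polyC line F) => t.
rewrite /mmap mevalE horner_sum; apply: eq_bigr => m _.
rewrite hornerM hornerC horner_prod; congr (_ * _).
by apply: eq_bigr => i _; rewrite horner_exp /line !hornerE.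
Qed.

(** On the line through [u] and [v] both restrict to nonzero univariate polynomials, whose product
    has a non-root in an algebraically closed field. *)
Lemma line_common_nonzero F G u v : F.@[u] != 0 -> G.@[v] != 0 ->
  exists t, F.@[fun k => u k + t * (v k - u k)] != 0 /\
            G.@[fun k => u k + t * (v k - u k)] != 0.
Proof.
move=> Fu Gv.
have [q qE] := meval_line F u v; have [r rE] := meval_line G u v.
have q0 : q != 0.
  apply: contraNneq Fu => q0; have := qE 0; rewrite q0 horner0 => ->.
  by apply/eqP/meval_eq => k; rewrite mul0r addr0.
have r0 : r != 0.
  apply: contraNneq Gv => r0; have := rE 1; rewrite r0 horner0 => ->.
  by apply/eqP/meval_eq => k; rewrite mul1r addrC subrK.
have /closed_nonrootP[t] : q * r != 0 by rewrite mulf_neq0.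
by rewrite rootE hornerM mulf_eq0 negb_or qE rE => /andP[]; exists t.
Qed.

Lemma card_bounded_monomials b : (#|{: 'X_{1..d < b}}| <= b ^ d)%N.
Proof.
have mlt (m : 'X_{1..d < b}) i : ((m : 'X_{1..d}) i < b)%N.
  apply: leq_ltn_trans (bmdeg m).
  by rewrite mdegE (bigD1 i) //= leq_addr.
pose phi (m : 'X_{1..d < b}) := [ffun i => Ordinal (mlt m i)].
have phi_inj : injective phi.
  move=> m1 m2 /ffunP eq12; apply: val_inj; apply/mnmP => i.
  by have /(congr1 val) := eq12 i; rewrite !ffunE.
by have := leq_card phi phi_inj; rewrite card_ffun !card_ord.
Qed.

Lemma bounded_degree_dependent (T : finType) (g : T -> {mpoly K[d]}) b :
    (forall t, msize (g t) <= b)%N -> (b ^ d < #|T|)%N ->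
  exists2 c : T -> K, (exists t, c t != 0) &
    forall v, \sum_t c t * (g t).@[v] = 0.
Proof.
move=> gb ltT.
(* The rows are the coefficient vectors of the [g t]; more rows than columns give a nonzero vector
   in the left kernel. *)
pose M := \matrix_(i < #|T|, j < #|{: 'X_{1..d < b}}|)
   (g (enum_val i))@_(enum_val j : 'X_{1..d < b}).
have : kermx M != 0.
  rewrite -mxrank_eq0 mxrank_ker subn_eq0 -ltnNge.
  apply: leq_ltn_trans ltT; apply: leq_trans (card_bounded_monomials b).
  exact: rank_leq_col.
case/rowV0Pn => w /sub_kermxP wM w0.
exists (fun t => w 0 (enum_rank t)).
  have [i wi] : exists i, w 0 i != 0.
    apply/existsP; apply: contraNT w0 => /existsPn w0.
    by apply/eqP/rowP => i; rewrite mxE; apply/eqP; rewrite -[_ == _]negbK.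
  by exists (enum_val i); rewrite enum_valK.
move=> v.
have gE t : (g t).@[v] =
    \sum_(m : 'X_{1..d < b}) (g t)@_m * \prod_i v i ^+ (m : 'X_{1..d}) i.
  by rewrite {1}(mpolywE (gb t)) raddf_sum; apply: eq_bigr => m _;
    rewrite /= mevalZ mevalX.
under eq_bigr do rewrite gE mulr_sumr.
rewrite exchange_big big1 //= => m _.
under eq_bigr do rewrite mulrA.
rewrite -mulr_suml; have /rowP/(_ (enum_rank m)) := wM.
rewrite !mxE (reindex_onto enum_rank enum_val) => [|i _]; last first.
  exact: enum_valK.
rewrite (eq_bigl xpredT) => [|t]; last by rewrite enum_rankK eqxx.
under eq_bigr do rewrite mxE !enum_rankK.
by move=> ->; rewrite mul0r.
Qed.

End MultivariatePolynomials.

(** * Graphs of rational maps *)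

Section RegularFunctions.
Local Open Scope ring_scope.
Local Open Scope classical_set_scope.
Variables (K : closedFieldType) (n d : nat) (S : set 'rV[K]_n).
Variables (prm : 'I_d -> {mpoly K[n]}) (h : {mpoly K[d]}).

Definition params (x : 'rV[K]_n) : 'I_d -> K := fun k => (prm k).@[x ord0].

(** On [S], the function is the fraction [g / h ^ N] in the parameters, cleared of its
    denominator. *)
Definition regular_on (F : 'rV[K]_n -> K) : Prop :=
  exists N (g : {mpoly K[d]}), forall x, S x ->
    F x * h.@[params x] ^+ N = g.@[params x].

Lemma regular_ext F G : (forall x, S x -> F x = G x) ->
  regular_on F -> regular_on G.
Proof.
by move=> FG [N [g Hg]]; exists N, g => x Sx; rewrite -FG // Hg.
Qed.

Lemma regular_const c : regular_on (fun=> c).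
Proof. by exists 0%N, c%:MP => x _; rewrite mulr1 mevalC. Qed.

Lemma regular_param k : regular_on (fun x => params x k).
Proof. by exists 0%N, 'X_k => x _; rewrite mulr1 mevalXU. Qed.

Lemma regularM F G : regular_on F -> regular_on G ->
  regular_on (fun x => F x * G x).
Proof.
move=> [N [f Hf]] [M [g Hg]]; exists (N + M)%N, (f * g) => x Sx.
by rewrite mevalM -Hf // -Hg // exprD mulrACA.
Qed.

Lemma regularD F G : regular_on F -> regular_on G ->
  regular_on (fun x => F x + G x).
Proof.
move=> [N [f Hf]] [M [g Hg]].
exists (N + M)%N, (f * h ^+ M + g * h ^+ N) => x Sx.
by rewrite mevalD !mevalM !rmorphXn /= -Hf // -Hg // exprD mulrDl; congr (_ + _);
  rewrite -mulrA // [X in _ * X]mulrC.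
Qed.

Lemma regularB F G : regular_on F -> regular_on G ->
  regular_on (fun x => F x - G x).
Proof.
move=> rF rG; apply: regularD => //.
apply: regular_ext (regularM (regular_const (-1)) rG) => x _.
by rewrite mulN1r.
Qed.

Lemma regular_sum (I : Type) (r : seq I) (P : pred I) (F : I -> 'rV[K]_n -> K) :
  (forall i, P i -> regular_on (F i)) ->
  regular_on (fun x => \sum_(i <- r | P i) F i x).
Proof.
move=> rF; elim: r => [|i r IHr].
  by apply: regular_ext (regular_const 0) => x _; rewrite big_nil.
have [Pi|Pi] := boolP (P i).
  by apply: regular_ext (regularD (rF i Pi) IHr) => x _; rewrite big_cons Pi.
by apply: regular_ext IHr => x _; rewrite big_cons (negPf Pi).
Qed.

Lemma regularX F k : regular_on F -> regular_on (fun x => F x ^+ k).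
Proof.
move=> rF; elim: k => [|k IHk]; first exact: regular_const.
by apply: regular_ext (regularM rF IHk) => x _; rewrite exprS.
Qed.

(** The division costs one more power of [h]; this is how determined coefficients are solved for. *)
Lemma regular_div F G : (forall x, S x -> F x * h.@[params x] = G x) ->
  regular_on G -> regular_on F.
Proof.
move=> FG [N [g Hg]]; exists N.+1, g => x Sx.
by rewrite exprS mulrA FG // Hg.
Qed.

Lemma regular_meval (f : {mpoly K[n]}) :
  (forall j, regular_on (fun x => x ord0 j)) ->
  regular_on (fun x => f.@[x ord0]).
Proof.
move=> rX; apply: regular_ext (_ : regular_on (fun x =>
  \sum_(m <- msupp f) f@_m * \prod_i x ord0 i ^+ m i)).
  by move=> x _; rewrite mevalE.
apply: regular_sum => m _; apply: regularM; first exact: regular_const.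
elim: (index_enum _) => [|i r IHr].
  by apply: regular_ext (regular_const 1) => x _; rewrite big_nil.
apply: regular_ext (regularM (regularX (m i) (rX i)) IHr) => x _.
by rewrite big_cons.
Qed.

End RegularFunctions.

(* [S] is the graph, over the principal open set [h != 0] of the affine space
   with coordinates [prm], of functions with denominators powers of [h]. *)
Definition rational_graph (K : closedFieldType) (n d : nat) (S : set 'rV[K]_n)
    (prm : 'I_d -> {mpoly K[n]}) (h : {mpoly K[d]}) : Prop :=
  ([/\ forall x, S x -> h.@[params prm x] != 0,
      forall v, h.@[v] != 0 -> exists2 x, S x & params prm x =1 v,
      forall j, regular_on S prm h (fun x => x ord0 j) &
      exists v, h.@[v] != 0])%R.

(** * Irreducibility and Krull dimension of the closure of a rational graph *)

Section RationalGraph.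
Local Open Scope ring_scope.
Local Open Scope classical_set_scope.
Variables (K : closedFieldType) (n d : nat) (S : set 'rV[K]_n).
Variables (prm : 'I_d -> {mpoly K[n]}) (h : {mpoly K[d]}).
Hypothesis graphS : rational_graph S prm h.

Let hS : forall x, S x -> h.@[params prm x] != 0.
Proof. by case: graphS. Qed.

Let surjS : forall v, h.@[v] != 0 -> exists2 x, S x & params prm x =1 v.
Proof. by case: graphS. Qed.

Let regS (f : {mpoly K[n]}) : regular_on S prm h (fun x => f.@[x ord0]).
Proof. by case: graphS => _ _ ? _; apply: regular_meval. Qed.

(** The condition on lines holds for sections of [S] by affine subspaces of the parameter space. If
    [B] misses [x] and [C] misses [y], both miss a point over a general point of the line joining
    the parameters of [x] and [y]. *)
Lemma rational_graph_section_irreducible (L : set 'rV[K]_n) :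
    L !=set0 -> L `<=` S ->
    (forall x y z t, L x -> L y -> S z ->
      (forall k, params prm z k =
         params prm x k + t * (params prm y k - params prm x k)) -> L z) ->
  irreducible_closed (zariski_closure L).
Proof.
move=> [x0 Lx0] sLS lineL; split.
- exact: zariski_closed_closure.
- by exists x0; apply: sub_zariski_closure.
move=> B C clB clC sBC.
have [?|nB] := pselect (L `<=` B); first by left; apply: zariski_closure_sub.
have [?|nC] := pselect (L `<=` C); first by right; apply: zariski_closure_sub.
exfalso.
have /existsNP[x /not_implyP[Lx nBx]] := nB.
have /existsNP[y /not_implyP[Ly nCy]] := nC.
have [f fB fx] := zariski_closed_separated clB nBx.
have [g gC gy] := zariski_closed_separated clC nCy.
have [N [F HF]] := regS f; have [M [G HG]] := regS g.
have [hx hy] := (hS (sLS _ Lx), hS (sLS _ Ly)).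
(* The factor [h] ensures that the parameter point found on the line lifts to [S]. *)
have Fx : (F * h).@[params prm x] != 0.
  by rewrite mevalM mulf_neq0 // -HF ?mulf_neq0 ?expf_neq0 //; apply: sLS.
have Gy : G.@[params prm y] != 0.
  by rewrite -HG ?mulf_neq0 ?expf_neq0 //; apply: sLS.
have [t []] := line_common_nonzero Fx Gy; rewrite mevalM mulf_eq0 negb_or.
case/andP=> Fw hw Gw; have [z Sz zE] := surjS hw.
have Lz : L z by apply: lineL Lx Ly Sz _ => k; rewrite zE.
move: Fw Gw; rewrite -!(meval_eq _ zE) -HF // -HG //.
have [/fB ->|/gC ->] := sBC z (sub_zariski_closure Lz).
  by rewrite mul0r eqxx.
by rewrite mul0r eqxx.
Qed.

Lemma rational_graph_nonempty : S !=set0.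
Proof. by case: graphS => _ _ _ [v /surjS[x Sx _]]; exists x. Qed.

Lemma rational_graph_irreducible : irreducible_closed (zariski_closure S).
Proof.
exact: rational_graph_section_irreducible rational_graph_nonempty _ _.
Qed.

(* Closures of the sections of [S] by a flag of affine subspaces. *)
Lemma rational_graph_chain :
  exists Z, irreducible_chain (zariski_closure S) d Z.
Proof.
have [_ _ _ [v hv]] := graphS; have [x0 Sx0 x0E] := surjS hv.
pose L i : set 'rV[K]_n :=
  [set x | S x /\ forall k : 'I_d, (i <= k)%N -> params prm x k = v k].
have sLS i : L i `<=` S by move=> x [].
exists (fun i => zariski_closure (L i)); split=> i lti.
  split; last first.
    apply: zariski_closure_sub; first exact: zariski_closed_closure.
    by move=> x /sLS; apply: sub_zariski_closure.
  apply: rational_graph_section_irreducible => //.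
    by exists x0; split=> // k _; rewrite x0E.
  move=> x y z t [Sx Lx] [Sy Ly] Sz zE; split=> // k leik.
  by rewrite zE Lx ?Ly // subrr mulr0 addr0.
split.
  apply: zariski_closure_sub; first exact: zariski_closed_closure.
  move=> x [Sx Lx]; apply: sub_zariski_closure; split=> // k ltik.
  by apply: Lx; apply: ltnW.
(* Along the line from [v] to [v'] only coordinate [k0] moves. A point over it with that coordinate
   changed lies in [L i.+1], and [prm k0 - v k0] separates it from the closure of [L i]. *)
pose k0 := Ordinal lti.
pose v' k := v k + (k == k0)%:R.
have v'k0 : ('X_k0 - (v k0)%:MP).@[v'] != 0.
  by rewrite mevalB mevalXU mevalC /v' eqxx addrC addKr oner_eq0.
have [t []] := line_common_nonzero hv v'k0.
set w := (w in h.@[w]); rewrite mevalB mevalXU mevalC subr_eq0 => hw wk0.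
have [x Sx xE] := surjS hw.
have Lx : L i.+1 x.
  split=> // k ltik; rewrite xE /w /v' (_ : k == k0 = false) ?addr0 ?subrr.
    by rewrite mulr0 addr0.
  by apply/negbTE; rewrite -val_eqE /= gtn_eqF.
have gL : vanishing (L i) (prm k0 - (v k0)%:MP).
  by move=> y [_ Ly]; rewrite mevalB mevalC; apply/eqP;
    rewrite subr_eq0; apply/eqP/Ly.
move=> /(_ x (sub_zariski_closure Lx) _ gL)/eqP.
by rewrite mevalB mevalC subr_eq0 -[meval _ _]/(params prm x k0) xE; apply/negP.
Qed.

(** For a chain of length [d + 1], the [s ^ (d + 1)] monomials in the separating functions are
    independent, yet clearing denominators turns them into polynomials in [d] variables of degree
    linear in [s], a space of dimension of order [s ^ d]. *)
Lemma rational_graph_chain_leq e Z :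
  irreducible_chain (zariski_closure S) e Z -> (e <= d)%N.
Proof.
move=> [irrZ subZ]; rewrite leqNgt; apply/negP => ltde.
have chZ : irreducible_chain (zariski_closure S) d.+1 Z.
  split=> i lei; first by apply: irrZ; apply: leq_trans ltde.
  by apply: subZ; apply: leq_trans ltde.
have [f fZ] := chain_functions chZ.
(* Multiplying by [h] raises the degree by less than [c], so the bound [c * D] on the degree of a
   numerator over [h ^ D] is compatible with products and with enlarging [D]. *)
pose c := (msize h).+1.
pose wt D (g : {mpoly K[n]}) := exists2 G : {mpoly K[d]},
  (msize G <= (c * D).+1)%N & forall x, S x ->
    g.@[x ord0] * h.@[params prm x] ^+ D = G.@[params prm x].
have hX k : (msize (h ^+ k) <= (c * k).+1)%N.
  by apply: msizeX_leq; rewrite 2?leqW.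
have wt1 : wt 0%N 1.
  by exists 1; rewrite ?msize1 // => x _; rewrite !meval1 mulr1.
have wtM a b g g' : wt a g -> wt b g' -> wt (a + b)%N (g * g').
  move=> [G Ga HG] [G' Gb HG']; exists (G * G').
    by rewrite mulnDr; apply: msizeM_leq.
  by move=> x Sx; rewrite !mevalM exprD mulrACA HG // HG'.
have wtW a b g : (a <= b)%N -> wt a g -> wt b g.
  move=> leab [G Ga HG]; exists (G * h ^+ (b - a)).
    by rewrite -(subnKC leab) mulnDr addKn; apply: msizeM_leq.
  by move=> x Sx; rewrite mevalM rmorphXn /= -HG // -mulrA -exprD subnKC.
have wt_ex i : exists D, wt D (f i).
  (* Extra powers of [h] in the denominator raise the weight until [c] times it bounds the degree of
     the numerator. *)
  have [N [G HG]] := regS (f i); exists (N + msize G)%N.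
  exists (G * h ^+ msize G).
    rewrite (@leq_trans (msize G + msize h * msize G).+1) //.
      by apply: msizeM_leq; [apply: leqnSn | apply: msizeX_leq; apply: leqnSn].
    by rewrite ltnS -mulSn leq_mul2l leq_addl orbT.
  by move=> x Sx; rewrite mevalM rmorphXn /= -HG // -mulrA -exprD.
have [Di Dif] := choice wt_ex.
pose D := (\max_(i < d.+1) Di i)%N.
have wtf i : (i < d.+1)%N -> wt D (f i).
  move=> lti; apply: wtW (Dif i).
  exact: (leq_bigmax (F := fun i : 'I_d.+1 => Di i) (Ordinal lti)).
(* The cleared numerators have size at most [q * s], so they span at most [q ^ d * s ^ d]
   dimensions; [s > q ^ d] makes the [s ^ (d + 1)] functions more numerous. *)
pose q := (c * (D * d.+1)).+1; pose s := (q ^ d).+1.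
have [T [u [cardT uZ wtu]]] := chain_independent s chZ fZ wt1 wtM wtW wtf.
have /choice[G GP] : forall t, exists G : {mpoly K[d]},
    (msize G <= (c * (D * s * d.+1)).+1)%N /\ forall x, S x ->
    (u t).@[x ord0] * h.@[params prm x] ^+ (D * s * d.+1) = G.@[params prm x].
  by move=> t; have [G] := wtu t; exists G.
have [||a [t at0] aG] := @bounded_degree_dependent _ _ T G (q * s)%N.
- move=> t; apply: leq_trans (GP t).1 _.
  by rewrite mulnAC mulnA /q mulSn addSn ltnS leq_addl.
- by rewrite cardT expnMn expnSr mulnC ltn_mul2l expn_gt0 ltnSn.
(* The relation among the numerators holds among the [u t] on [S], where [h] is nonzero, and passes
   to the closure. *)
pose r := \sum_t a t *: u t.
have rE x : r.@[x ord0] = \sum_t a t * (u t).@[x ord0].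
  by rewrite raddf_sum; apply: eq_bigr => k _; rewrite /= mevalZ.
have rS : vanishing S r.
  move=> x Sx; apply: (mulIf (expf_neq0 (D * s * d.+1) (hS Sx))).
  rewrite mul0r rE mulr_suml -[RHS](aG (params prm x)).
  by apply: eq_bigr => k _; rewrite -mulrA (GP k).2.
have a0 x : Z d.+1 x -> \sum_t a t * (u t).@[x ord0] = 0.
  by move=> Zx; rewrite -rE; apply: (chZ.1 d.+1 (leqnn _)).2 Zx r rS.
by move/eqP: (uZ a a0 t); rewrite (negPf at0).
Qed.

Lemma rational_graph_dim : has_dim (zariski_closure S) d.
Proof.
by split; [apply: rational_graph_chain | apply: rational_graph_chain_leq].
Qed.

End RationalGraph.

(** * The strata of G1 *)

Section GeneratingPolynomials.
Local Open Scope ring_scope.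
Variables (K : closedFieldType) (p : nat).
Implicit Types (a b c : nat -> K).

Definition genpoly a : {poly K} := \sum_(1 <= k < p.+1) a k *: 'X^k.

Lemma coef_genpoly a k :
  (genpoly a)`_k = if (1 <= k <= p)%N then a k else 0.
Proof.
rewrite coef_sum; case: ifP => [kp|kp].
  rewrite (bigD1_seq k) ?iota_uniq ?mem_index_iota //= coefZ coefXn eqxx mulr1.
  by rewrite big1 ?addr0 // => i ik; rewrite coefZ coefXn eq_sym (negPf ik) mulr0.
rewrite big_seq big1 // => i; rewrite mem_index_iota ltnS => ip.
by rewrite coefZ coefXn; case: eqP => [ki|_]; [rewrite ki ip in kp | rewrite mulr0].
Qed.

Lemma eq_genpoly a b : (forall k, (1 <= k <= p)%N -> a k = b k) ->
  genpoly a = genpoly b.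
Proof. by move=> ab; apply/polyP => k; rewrite !coef_genpoly; case: ifP => // /ab. Qed.

Lemma size_genpoly a l : (forall k, (l < k <= p)%N -> a k = 0) ->
  (size (genpoly a) <= l.+1)%N.
Proof.
move=> a0; apply/leq_sizeP => k ltk; rewrite coef_genpoly.
by case: ifP => // /andP[_ lekp]; rewrite a0 // ltk.
Qed.

Lemma size_genpoly_leq a : (size (genpoly a) <= p.+1)%N.
Proof. by apply: size_genpoly => k; lia. Qed.

Lemma genpoly_coef (q : {poly K}) :
  q`_0 = 0 -> (size q <= p.+1)%N -> genpoly (fun k => q`_k) = q.
Proof.
move=> q0 /leq_sizeP sq; apply/polyP => k; rewrite coef_genpoly.
case: ifP => // /negbT; rewrite negb_and -!leqNgt leqn0 => /orP[/eqP->//|].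
by rewrite -ltnNge => /sq.
Qed.

Lemma coef_genpolyM a b j : (genpoly a * genpoly b)`_j =
  \sum_(1 <= s < p.+1) \sum_(1 <= t < p.+1 | (s + t == j)%N) a s * b t.
Proof.
rewrite mulr_suml coef_sum; apply: eq_bigr => s _.
rewrite mulr_sumr coef_sum [RHS]big_mkcond; apply: eq_bigr => t _.
rewrite -scalerAl -scalerAr scalerA -exprD coefZ coefXn eq_sym.
by case: eqP; rewrite ?mulr1 ?mulr0.
Qed.

Lemma coef_genpolyMM a b c j : (genpoly a * genpoly b * genpoly c)`_j =
  \sum_(1 <= r < p.+1) \sum_(1 <= s < p.+1)
    \sum_(1 <= t < p.+1 | (r + s + t == j)%N) a r * b s * c t.
Proof.
rewrite -mulrA mulr_suml coef_sum; apply: eq_bigr => r _.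
rewrite mulr_suml mulr_sumr coef_sum; apply: eq_bigr => s _.
rewrite !mulr_sumr coef_sum [RHS]big_mkcond; apply: eq_bigr => t _.
rewrite -!(scalerAl, scalerAr) !scalerA -!exprD coefZ coefXn eq_sym addnA mulrA.
by case: eqP; rewrite ?mulr1 ?mulr0.
Qed.

(* Euclidean division by [X^(p-l+1) D], of degree [p + 1]. *)
Lemma truncating_multiple (F D : {poly K}) l :
    (l <= p)%N -> size D = l.+1 -> (size F <= (p + l).+1)%N ->
  exists2 q : {poly K}, (size q <= l)%N &
    (size (F + 'X^((p - l).+1) * q * D)%R <= p.+1)%N.
Proof.
move=> lep sD sF; set Q := 'X^((p - l).+1) * D.
have D0 : D != 0 by rewrite -size_poly_gt0 sD.
have sQ : size Q = p.+2 by rewrite size_monicM ?monicXn // size_polyXn sD; lia.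
have Q0 : Q != 0 by rewrite -size_poly_gt0 sQ.
exists (- (F %/ Q)); first by rewrite size_polyN size_divp // sQ leq_subLR.
have -> : F + 'X^((p - l).+1) * - (F %/ Q) * D = F %% Q.
  by rewrite {1}(divp_eq F Q) /Q; ring.
by rewrite -ltnS -sQ ltn_modp.
Qed.

End GeneratingPolynomials.

(** * Reduction of the equations to a degree bound, and the stratification by degrees *)

Section Strata.
Local Open Scope ring_scope.
Local Open Scope classical_set_scope.
Variables (K : closedFieldType) (p : nat).
Implicit Types (x : 'rV[K]_(9 * p)) (sw : bool).
Local Notation X := (X K p).

Definition generating (F : nat -> {mpoly K[9 * p]}) x : {poly K} :=
  genpoly p (fun k => (F k).@[x ord0]).

(* The equations are invariant under exchanging [X 1 3] with [X 3 2] and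
   [X 3 1] with [X 2 3]; [sw] selects one of the two orientations. *)
Definition cA sw k := if sw then X 3 2 k else X 1 3 k.
Definition cB sw k := if sw then X 2 3 k else X 3 1 k.
Definition cC sw k := cB (~~ sw) k.
Definition cD sw k := cA (~~ sw) k.
Definition cE k := X 2 1 k.

(** When [X 1 2] and [X 2 2] vanish, the equations [p3 j] equate the coefficients of this polynomial
    with [X 3 3 j] up to degree [p] and with 0 above. *)
Definition defect sw x : {poly K} :=
  generating (cA sw) x * generating (cB sw) x
  + generating (cC sw) x * generating (cD sw) x
  - generating (cA sw) x * generating cE x * generating (cD sw) x.

Lemma defect_swap sw x : defect sw x = defect false x.
Proof. by case: sw => //; rewrite /defect /cC /cD /=; ring. Qed.

Lemma size_defect x : (size (defect false x) <= (3 * p).+1)%N.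
Proof.
have sg F := size_genpoly_leq p (fun k => (F k).@[x ord0]).
have sM (q r : {poly K}) a b : (size q <= a.+1)%N -> (size r <= b.+1)%N ->
    (size (q * r)%R <= (a + b).+1)%N.
  by move=> qa rb; apply: leq_trans (size_polyMleq _ _) _; lia.
rewrite /defect; apply: leq_trans (size_polyD _ _) _.
rewrite size_polyN geq_max; apply/andP; split; last first.
  by rewrite (leq_trans (sM _ _ _ _ (sM _ _ _ _ (sg _) (sg _)) (sg _))) //; lia.
apply: leq_trans (size_polyD _ _) _; rewrite geq_max.
by rewrite !(leq_trans (sM _ _ _ _ (sg _) (sg _))) //; lia.
Qed.

Lemma p3E x j : (forall k, (1 <= k <= p)%N ->
    (X 1 2 k).@[x ord0] = 0 /\ (X 2 2 k).@[x ord0] = 0) ->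
  (p3 K p j).@[x ord0] =
    (if (j <= p)%N then (X 3 3 j).@[x ord0] else 0) - (defect false x)`_j.
Proof.
move=> x0; rewrite /p3 mevalB mevalD mevalB.
have -> : (eps K p j).@[x ord0] = if (j <= p)%N then (X 3 3 j).@[x ord0] else 0.
  by rewrite /eps; case: ifP; rewrite ?meval0.
rewrite /defect !coefB coefD !coef_genpolyM coef_genpolyMM.
set s1 := (X in _ - X + _ - _); set s2 := (X in _ - _ + X - _).
set s3 := (X in _ - _ + _ - X).
have -> : s1 = \sum_(1 <= s < p.+1) \sum_(1 <= t < p.+1 | (s + t == j)%N)
      ((X 1 3 s).@[x ord0] * (X 3 1 t).@[x ord0]) +
    \sum_(1 <= s < p.+1) \sum_(1 <= t < p.+1 | (s + t == j)%N)
      ((X 2 3 s).@[x ord0] * (X 3 2 t).@[x ord0]).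
  rewrite -big_split /s1 raddf_sum; apply: eq_bigr => s _.
  rewrite /= raddf_sum -big_split; apply: eq_bigr => t _.
  by rewrite /= mevalD !mevalM.
have -> : s2 = \sum_(1 <= r < p.+1) \sum_(1 <= s < p.+1)
    \sum_(1 <= t < p.+1 | (r + s + t == j)%N)
      (X 1 3 r).@[x ord0] * (X 2 1 s).@[x ord0] * (X 3 2 t).@[x ord0].
  rewrite /s2 raddf_sum; apply: eq_big_nat => r rp.
  rewrite /= raddf_sum; apply: eq_bigr => s _.
  rewrite /= raddf_sum; apply: eq_bigr => t _.
  by rewrite /= mevalD !mevalM (x0 r rp).1 !mul0r add0r.
have -> : s3 = 0.
  rewrite /s3 raddf_sum big1 // => r _.
  rewrite /= raddf_sum big_nat big1 // => s sp.
  rewrite /= raddf_sum big1 // => t _.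
  by rewrite /= !mevalM (x0 s sp).2 mulr0 mul0r.
by rewrite /cA /cB /cC /cD /cE /=; ring.
Qed.

(** With [X 1 2] zero, [p2 j] reduces to [X 2 2 j]. The equations [p3 j] with [p < j <= 3 * p] reach
    every higher degree that the defect can have, so they amount to a degree bound. *)
Lemma G1P x : G1 K p x <->
  [/\ forall k, (1 <= k <= p)%N -> [/\ (X 1 1 k).@[x ord0] = 0,
         (X 1 2 k).@[x ord0] = 0 & (X 2 2 k).@[x ord0] = 0],
      forall k, (1 <= k <= p)%N -> (X 3 3 k).@[x ord0] = (defect false x)`_k &
      (size (defect false x) <= p.+1)%N].
Proof.
have p2E j : (j <= p)%N ->
    (forall k, (1 <= k <= p)%N -> (X 1 2 k).@[x ord0] = 0) ->
    (p2 K p j).@[x ord0] = (X 2 2 j).@[x ord0].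
  move=> lejp x0; rewrite /p2 mevalB [X in _ - X]raddf_sum big_nat big1 ?subr0 // => t tj.
  by rewrite /= mevalM x0 ?mul0r //; lia.
split=> [Gx|[x0 x33 sx]].
  have x12 k : (1 <= k <= p)%N -> (X 1 2 k).@[x ord0] = 0.
    by move=> kp; apply: Gx; left; exists k => //; constructor 3.
  have x11 k : (1 <= k <= p)%N -> (X 1 1 k).@[x ord0] = 0.
    by move=> kp; apply: Gx; left; exists k => //; constructor 1.
  have x22 k : (1 <= k <= p)%N -> (X 2 2 k).@[x ord0] = 0.
    move=> kp; rewrite -p2E //; last by case/andP: kp.
    by apply: Gx; left; exists k => //; constructor 2.
  have x3 j : (1 <= j <= 3 * p)%N ->
      (if (j <= p)%N then (X 3 3 j).@[x ord0] else 0) = (defect false x)`_j.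
    move=> jp; apply/eqP; rewrite -subr_eq0 -p3E => [|k kp].
      by apply/eqP/Gx; right; exists j.
    by split; [apply: x12 | apply: x22].
  split=> [k kp|k kp|]; first by split; [apply: x11|apply: x12|apply: x22].
    by rewrite -x3; [case/andP: kp => _ -> | lia].
  apply/leq_sizeP => j ltpj; have [le3p|lt3p] := leqP j (3 * p).
    by rewrite -x3; [rewrite leqNgt ltpj | lia].
  by move/leq_sizeP: (size_defect x); apply.
move=> f [[j jp [->|->|->]]|[j jp ->]].
- by have [] := x0 j jp.
- rewrite p2E; first by have [] := x0 j jp.
    by case/andP: jp.
  by move=> k /x0[].
- by have [] := x0 j jp.
rewrite p3E => [|k /x0[]//]; case: leqP => [lejp|ltpj].
  by rewrite x33 ?subrr //; lia.
by move/leq_sizeP: sx => ->; rewrite ?subrr.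
Qed.

(** The generating polynomials of [cA], [cE] and [cD] have degree at most [m], at most [p - m] and
    exactly [l]; for [l = 0] the last one is zero, having no constant term. *)
Definition stratum sw m l : set 'rV[K]_(9 * p) :=
  [set x | G1 K p x /\
    [/\ forall k, (m < k <= p)%N -> (cA sw k).@[x ord0] = 0,
        forall k, (p - m < k <= p)%N -> (cE k).@[x ord0] = 0,
        forall k, (l < k <= p)%N -> (cD sw k).@[x ord0] = 0 &
        (0 < l)%N -> (cD sw l).@[x ord0] != 0]].

Lemma strata_cover x : G1 K p x ->
  exists sw m l, (m <= l <= p)%N /\ stratum sw m l x.
Proof.
move=> Gx; have [_ _ sx] := (G1P x).1 Gx.
pose sA sw := size (generating (cA sw) x).
have [sw leAD] : exists sw, (sA sw <= sA (~~ sw))%N.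
  by have [leq|/ltnW leq] := leqP (sA false) (sA true); [exists false|exists true].
set A := generating (cA sw) x in leAD; set D := generating (cD sw) x in leAD.
set E := generating cE x.
have sD : (size D <= p.+1)%N by apply: size_genpoly_leq.
(* These are the degrees, with 0 for the zero polynomial. *)
exists sw, (size A).-1, (size D).-1; split.
  by rewrite /sA -/A -/D in leAD *; lia.
have coefg F k : (1 <= k <= p)%N -> (F k).@[x ord0] = (generating F x)`_k.
  by move=> kp; rewrite coef_genpoly kp.
have coef0 F k : ((size (generating F x)).-1 < k <= p)%N -> (F k).@[x ord0] = 0.
  move=> /andP[ltk lekp]; rewrite coefg ?nth_default //.
    exact: leq_trans (leqSpred _) ltk.
  by rewrite lekp andbT; apply: leq_ltn_trans ltk.
split=> //; split=> [k kp|k kp|k kp|l0].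
- exact: coef0.
- apply: coef0; case/andP: kp => ltk lekp; rewrite lekp andbT -/E.
  have [A0|A0] := eqVneq A 0; first by rewrite A0 size_poly0 /= subn0 in ltk; lia.
  have [->|E0] := eqVneq E 0; first by rewrite size_poly0 /=; lia.
  (* Otherwise the degree of [A * E * D] exceeds [p] plus that of [D], which bounds the rest of the
     defect because [A] has at most the degree of [D]. The top term then survives and the defect has
     degree above [p]. *)
  rewrite ltnNge; apply/negP => leE.
  have D0 : D != 0.
    by rewrite -size_poly_gt0 (leq_trans _ leAD) // size_poly_gt0.
  have [A1 E1 D1] : [/\ (0 < size A)%N, (0 < size E)%N & (0 < size D)%N].
    by rewrite !size_poly_gt0.
  have sAED : size (A * E * D) = (size A + size E + size D).-2.
    rewrite !size_mul ?mulf_neq0 //; move: A1 E1 D1.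
    by move: (size A) (size E) (size D); lia.
  have sB : (size (generating (cB sw) x) <= p.+1)%N by apply: size_genpoly_leq.
  have sC : (size (generating (cC sw) x) <= p.+1)%N by apply: size_genpoly_leq.
  have sABCD : (size (A * generating (cB sw) x + generating (cC sw) x * D)%R
      <= p + size D)%N.
    apply: leq_trans (size_polyD _ _) _; rewrite geq_max.
    rewrite !(leq_trans (size_polyMleq _ _)) //; first by lia.
    by rewrite /sA -/A -/D in leAD; lia.
  have : size (defect sw x) = size (A * E * D).
    rewrite /defect addrC size_polyDl size_polyN // sAED.
    apply: leq_ltn_trans sABCD _; move: ltk leE A1 E1 D1.
    by move: (size A) (size E) (size D); lia.
  move: sx; rewrite -(defect_swap sw) => /[swap] ->; rewrite sAED.
  move: ltk leE A1 E1 D1.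
  by move: (size A) (size E) (size D); lia.
- exact: coef0.
- rewrite coefg -/D; last by lia.
  by rewrite -/(lead_coef _) lead_coef_eq0 -size_poly_gt0; apply: leq_trans (leq_pred _).
Qed.

End Strata.

(** * Coordinates of a point in terms of index triples *)

Section Entries.
Local Open Scope ring_scope.
Variable K : closedFieldType.

(** Out of range the value is 0, matching the default of [X], so that [meval_entry] holds for all
    indices. *)
Definition entry n (v : 'I_n -> K) (i : nat) : K :=
  if insub i is Some k then v k else 0.

Lemma entry_ord n (v : 'I_n -> K) (i : 'I_n) : entry v i = v i.
Proof. by rewrite /entry valK. Qed.

Lemma meval_entry p (x : 'rV[K]_(9 * p)) i j k :
  (X K p i j k).@[x ord0] = entry (x ord0) ((i.-1 * 3 + j.-1) * p + k.-1).
Proof. by rewrite /X /entry; case: insubP => [l _ _|_]; rewrite ?mevalXU ?meval0. Qed.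

(** Division with remainder by [p] and then by 3 recovers the triple from its position. *)
Lemma meval_row p (F : nat -> nat -> nat -> K) (x : 'rV[K]_(9 * p)) i j k :
    (forall l, x ord0 l = F (l %/ p %/ 3).+1 (l %/ p %% 3).+1 (l %% p).+1) ->
    (0 < i <= 3)%N -> (0 < j <= 3)%N -> (0 < k <= p)%N ->
  (X K p i j k).@[x ord0] = F i j k.
Proof.
move=> xE i3 j3 kp; rewrite meval_entry.
have lt9 : ((i.-1 * 3 + j.-1) * p + k.-1 < 9 * p)%N.
  have : (i.-1 * 3 + j.-1 <= 8)%N by lia.
  by move: (i.-1 * 3 + j.-1)%N => b; nia.
rewrite (entry_ord _ (Ordinal lt9)) xE /=.
have p0 : (0 < p)%N by lia.
have k0 : (k.-1 < p)%N by lia.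
rewrite divnMDl // modnMDl (divn_small k0) (modn_small k0) addn0.
have j0 : (j.-1 < 3)%N by lia.
rewrite divnMDl // modnMDl (divn_small j0) (modn_small j0) addn0.
by rewrite !prednK //; [case/andP: kp | case/andP: j3 | case/andP: i3].
Qed.

End Entries.

(** * Each stratum as a rational graph in [3 * p] parameters *)

Section StratumParametrization.
Local Open Scope ring_scope.
Local Open Scope classical_set_scope.
Variables (K : closedFieldType) (p : nat) (sw : bool) (m l : nat).
Hypotheses (leml : (m <= l)%N) (lelp : (l <= p)%N).
Implicit Types (x : 'rV[K]_(9 * p)).
Local Notation X := (X K p).
Local Notation S := (@stratum K p sw m l).
Local Notation A := (cA K p sw).
Local Notation B := (cB K p sw).
Local Notation C := (cC K p sw).
Local Notation D := (cD K p sw).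
Local Notation E := (cE K p).

(* Three blocks of [p] parameters: the coefficients of [A] up to [m] and of [E]
   up to [p - m]; those of [D] up to [l] and of [C] up to [p - l]; those of
   [B]. *)
Definition stratum_params (i : 'I_(3 * p)) : {mpoly K[9 * p]} :=
  let k := (i %% p)%N.+1 in
  match (i %/ p)%N with
  | 0 => if (k <= m)%N then A k else E (k - m)
  | 1 => if (k <= l)%N then D k else C (k - l)
  | _ => B k
  end.

Definition block (v : 'I_(3 * p) -> K) q k := entry v (q * p + k.-1).

Lemma blockP v q k : (q < 3)%N -> (0 < k <= p)%N ->
  exists i : 'I_(3 * p), [/\ block v q k = v i, (i %/ p)%N = q & (i %% p)%N.+1 = k].
Proof.
move=> q3 kp; have lt3 : (q * p + k.-1 < 3 * p)%N by nia.
exists (Ordinal lt3); split; first by rewrite /block (entry_ord _ (Ordinal lt3)).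
  by rewrite /= divnMDl ?divn_small; lia.
by rewrite /= modnMDl modn_small; lia.
Qed.

Lemma block_ord v (i : 'I_(3 * p)) : block v (i %/ p)%N (i %% p)%N.+1 = v i.
Proof. by rewrite /block /= -divn_eq entry_ord. Qed.

(* The leading coefficient [D l] of [D]; for [l = 0] nothing is inverted. The
   default value of the [insub] is never reached. *)
Definition stratum_den : {mpoly K[3 * p]} :=
  if (l == 0)%N then 1
  else if insub (p + l.-1)%N is Some i then 'X_i else 1.

Lemma stratum_denE v : stratum_den.@[v] = if (l == 0)%N then 1 else block v 1 l.
Proof.
rewrite /stratum_den; case: eqP => [_|l0]; first exact: meval1.
have lt3 : (p + l.-1 < 3 * p)%N by lia.
by rewrite /block /entry mul1n insubT /= mevalXU.
Qed.

Local Notation prm := (params stratum_params).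

Lemma block0_A x k : (0 < k <= m)%N -> block (prm x) 0 k = (A k).@[x ord0].
Proof.
move=> km; have [|i [-> ip im]] := @blockP (prm x) 0 k isT; first by lia.
by rewrite /params /stratum_params ip im ifT //; lia.
Qed.

Lemma block0_E x k : (0 < k <= p - m)%N -> block (prm x) 0 (m + k) = (E k).@[x ord0].
Proof.
move=> km; have [|i [-> ip im]] := @blockP (prm x) 0 (m + k) isT; first by lia.
by rewrite /params /stratum_params ip im ifF ?addKn //; lia.
Qed.

Lemma block1_D x k : (0 < k <= l)%N -> block (prm x) 1 k = (D k).@[x ord0].
Proof.
move=> km; have [|i [-> ip im]] := @blockP (prm x) 1 k isT; first by lia.
by rewrite /params /stratum_params ip im ifT //; lia.
Qed.

Lemma block1_C x k : (0 < k <= p - l)%N -> block (prm x) 1 (l + k) = (C k).@[x ord0].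
Proof.
move=> km; have [|i [-> ip im]] := @blockP (prm x) 1 (l + k) isT; first by lia.
by rewrite /params /stratum_params ip im ifF ?addKn //; lia.
Qed.

Lemma block2_B x k : (0 < k <= p)%N -> block (prm x) 2 k = (B k).@[x ord0].
Proof.
move=> km; have [//|i [-> ip im]] := @blockP (prm x) 2 k isT.
by rewrite /params /stratum_params ip im.
Qed.

Lemma stratum_den_params x :
  stratum_den.@[prm x] = if (l == 0)%N then 1 else (D l).@[x ord0].
Proof. by rewrite stratum_denE; case: eqP => // l0; rewrite block1_D //; lia. Qed.

Lemma stratum_den_neq0 x : S x -> stratum_den.@[prm x] != 0.
Proof.
move=> [_ [_ _ _ Dl]]; rewrite stratum_den_params.
by case: posnP => [|/Dl]; rewrite ?oner_eq0.
Qed.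

Section Regularity.
Local Notation regular := (regular_on S stratum_params stratum_den).

Lemma regular_block q k : (q < 3)%N -> (0 < k <= p)%N ->
  regular (fun x => block (prm x) q k).
Proof.
move=> q3 kp; have [i [_ ip im]] := @blockP (fun=> 0) q k q3 kp.
apply: regular_ext (regular_param S stratum_params stratum_den i) => x _.
by rewrite -ip -im block_ord.
Qed.

Lemma regular_zero F : (forall x, S x -> F x = 0) -> regular F.
Proof.
by move=> F0; apply: regular_ext (regular_const _ _ _ 0) => x /F0.
Qed.

Lemma regular_A k : (0 < k <= p)%N -> regular (fun x => (A k).@[x ord0]).
Proof.
move=> kp; have [km|mk] := leqP k m.
  by apply: regular_ext (regular_block (q := 0) isT kp) => x _; rewrite block0_A //; lia.
by apply: regular_zero => x [_ [-> //]]; lia.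
Qed.

Lemma regular_E k : (0 < k <= p)%N -> regular (fun x => (E k).@[x ord0]).
Proof.
move=> kp; have [km|mk] := leqP k (p - m).
  have mkp : (0 < m + k <= p)%N by lia.
  by apply: regular_ext (regular_block (q := 0) isT mkp) => x _; rewrite block0_E //; lia.
by apply: regular_zero => x [_ [_ -> //]]; lia.
Qed.

Lemma regular_D k : (0 < k <= p)%N -> regular (fun x => (D k).@[x ord0]).
Proof.
move=> kp; have [km|mk] := leqP k l.
  by apply: regular_ext (regular_block (q := 1) isT kp) => x _; rewrite block1_D //; lia.
by apply: regular_zero => x [_ [_ _ D0 _]]; rewrite D0 //; lia.
Qed.

Lemma regular_B k : (0 < k <= p)%N -> regular (fun x => (B k).@[x ord0]).
Proof.
move=> kp.
by apply: regular_ext (regular_block (q := 2) isT kp) => x _; rewrite block2_B.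
Qed.

Lemma regular_generating F :
    (forall k, (0 < k <= p)%N -> regular (fun x => (F k).@[x ord0])) ->
  forall k, regular (fun x => (generating F x)`_k).
Proof.
move=> rF k; have [kp|kp] := boolP (0 < k <= p)%N.
  by apply: regular_ext (rF k kp) => x _; rewrite coef_genpoly kp.
by apply: regular_zero => x _; rewrite coef_genpoly (negPf kp).
Qed.

Lemma regular_coefM (F G : 'rV[K]_(9 * p) -> {poly K}) :
    (forall k, regular (fun x => (F x)`_k)) ->
    (forall k, regular (fun x => (G x)`_k)) ->
  forall k, regular (fun x => (F x * G x)`_k).
Proof.
move=> rF rG k; apply: regular_ext (_ : regular (fun x =>
  \sum_(i < k.+1) (F x)`_i * (G x)`_(k - i))); first by move=> x _; rewrite coefM.
by apply: regular_sum => i _; apply: regularM.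
Qed.

(* The coefficient of degree [k + l > p] of [A B + C D - A E D] vanishes and
   contains [C k * D l]; its other terms involve only [C i] with [i > k]. *)
Lemma regular_C k : (0 < k <= p)%N -> regular (fun x => (C k).@[x ord0]).
Proof.
have [n] := ubnP (p - k); elim: n k => // n IHn k ltn kp.
have [klp|ltk] := leqP k (p - l).
  have lkp : (0 < l + k <= p)%N by lia.
  by apply: regular_ext (regular_block (q := 1) isT lkp) => x _; rewrite block1_C //; lia.
have l0 : (0 < l)%N by lia.
pose gA x := generating A x; pose gB x := generating B x.
pose gC x := generating C x; pose gD x := generating D x; pose gE x := generating E x.
have kl : (k < (k + l).+1)%N by lia.
pose G x := (gA x * gE x * gD x)`_(k + l) - (gA x * gB x)`_(k + l) -
   \sum_(i < (k + l).+1 | i != Ordinal kl) (gC x)`_i * (gD x)`_(k + l - i).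
apply: (regular_div (G := G)) => [x Sx|].
  have [Gx _] := Sx; have [_ _ sx] := (G1P x).1 Gx.
  rewrite stratum_den_params gtn_eqF //.
  have : (defect sw x)`_(k + l) = 0.
    by rewrite defect_swap; move/leq_sizeP: sx; apply; lia.
  rewrite /defect coefB coefD [(generating C x * _)`_ _]coefM.
  rewrite (bigD1 (Ordinal kl)) //= addKn /G /gA /gB /gC /gD /gE.
  rewrite [(generating C x)`_k]coef_genpoly kp.
  rewrite [(generating D x)`_l]coef_genpoly l0 lelp.
  by move=> /eqP; rewrite subr_eq0 => /eqP <-; ring.
have rA := regular_generating regular_A; have rE := regular_generating regular_E.
have rB := regular_generating regular_B; have rD := regular_generating regular_D.
apply: regularB.
  by apply: regularB; do ?[apply: regular_coefM => //].
apply: regular_sum => i /negbTE neik.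
(* For [i < k] the factor from [D] has index above [l] and vanishes on the stratum; for [i > k] the
   induction hypothesis applies. *)
have [ltik|ltki|eqik] := ltngtP i k.
- apply: regular_zero => x [_ [_ _ D0 _]]; rewrite [(gD x)`_ _]coef_genpoly.
  by case: ifP => [ip|_]; rewrite ?D0 ?mulr0 //; lia.
- apply: regularM => //; have [ip|ip] := leqP i p; last first.
    by apply: regular_zero => x _; rewrite coef_genpoly ifF //; lia.
  have rCi := IHn i; apply: regular_ext (rCi _ _) => [x _||]; last 2 first.
  + lia.
  + lia.
  by rewrite coef_genpoly ifT //; lia.
by rewrite -val_eqE /= eqik eqxx in neik.
Qed.

Lemma regular_coord (j : 'I_(9 * p)) : regular (fun x => x ord0 j).
Proof.
have p0 : (0 < p)%N by case: p j => [|//] [j]; rewrite muln0.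
have rA s k : (0 < k <= p)%N -> regular (fun x => (cA K p s k).@[x ord0]).
  move=> kp; have [->|->] : s = sw \/ s = ~~ sw.
    by case: (s) (sw) => [] []; by [left|right].
  - exact: regular_A.
  - exact: regular_D.
have rB s k : (0 < k <= p)%N -> regular (fun x => (cB K p s k).@[x ord0]).
  move=> kp; have [->|->] : s = sw \/ s = ~~ sw.
    by case: (s) (sw) => [] []; by [left|right].
  - exact: regular_B.
  - exact: regular_C.
have r0 k : (0 < k <= p)%N -> forall x, S x -> [/\ (X 1 1 k).@[x ord0] = 0,
    (X 1 2 k).@[x ord0] = 0 & (X 2 2 k).@[x ord0] = 0].
  by move=> kp x [/G1P[x0 _ _] _]; apply: x0.
have rdefect k : regular (fun x => (defect false x)`_k).
  have rgA s := regular_generating (rA s); have rgB s := regular_generating (rB s).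
  have rgE := regular_generating regular_E.
  apply: regular_ext (_ : regular (fun x =>
     (generating (cA K p false) x * generating (cB K p false) x)`_k +
     (generating (cC K p false) x * generating (cD K p false) x)`_k -
     (generating (cA K p false) x * generating E x * generating (cD K p false) x)`_k)).
    by move=> x _; rewrite /defect coefB coefD.
  apply: regularB; last by do ?[apply: regular_coefM => //]; apply: rgA.
  by apply: regularD; apply: regular_coefM; by [apply: rgA | apply: rgB].
set k := (j %% p).+1%N; have kp : (0 < k <= p)%N by rewrite /k ltn_pmod.
suff rX : forall b, (b < 9)%N ->
    regular (fun x => (X (b %/ 3).+1 (b %% 3).+1 k).@[x ord0]).
  have b9 : (j %/ p < 9)%N by rewrite ltn_divLR.
  apply: regular_ext (rX _ b9) => x _.
  by rewrite meval_entry /= -divn_eq /k /= -divn_eq entry_ord.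
(* The blocks come in the order 11, 12, 13, 21, 22, 23, 31, 32, 33. *)
case=> [|[|[|[|[|[|[|[|[|//]]]]]]]]] _.
- by apply: regular_zero => x /(r0 k kp)[].
- by apply: regular_zero => x /(r0 k kp)[].
- exact: (rA false).
- exact: regular_E.
- by apply: regular_zero => x /(r0 k kp)[].
- exact: (rB true).
- exact: (rB false).
- exact: (rA true).
- by apply: regular_ext (rdefect k) => x [/G1P[_ x33 _] _]; rewrite -x33.
Qed.

End Regularity.

(** The parameters prescribe [A], [B], [D], [E] and the low part of [C]; the high part of [C] is
    chosen to bring the degree of the defect down to [p], and [X 3 3] is read off from the
    defect. *)
Lemma stratum_surjective v : stratum_den.@[v] != 0 ->
  exists2 x, S x & prm x =1 v.
Proof.
rewrite stratum_denE => denv.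
pose a k := if (k <= m)%N then block v 0 k else 0.
pose e k := if (k <= p - m)%N then block v 0 (m + k) else 0.
pose d k := if (k <= l)%N then block v 1 k else 0.
pose b k := block v 2 k.
pose c0 k := if (k <= p - l)%N then block v 1 (l + k) else 0.
pose ga := genpoly p a; pose ge := genpoly p e; pose gd := genpoly p d.
pose gb := genpoly p b; pose gc0 := genpoly p c0.
have sa : (size ga <= m.+1)%N.
  by apply: size_genpoly => k km; rewrite /a ifF //; lia.
have se : (size ge <= (p - m).+1)%N.
  by apply: size_genpoly => k km; rewrite /e ifF //; lia.
have sd : (size gd <= l.+1)%N.
  by apply: size_genpoly => k km; rewrite /d ifF //; lia.
have sc0 : (size gc0 <= (p - l).+1)%N.
  by apply: size_genpoly => k km; rewrite /c0 ifF //; lia.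
have sb : (size gb <= p.+1)%N by apply: size_genpoly_leq.
have sM (q r : {poly K}) i j n : (size q <= i.+1)%N -> (size r <= j.+1)%N ->
    (i + j <= n)%N -> (size (q * r)%R <= n.+1)%N.
  by move=> qi rj ijn; apply: leq_trans (size_polyMleq _ _) _; lia.
have [c [c00 cE sdef]] : exists c : {poly K}, [/\ c`_0 = 0 /\ (size c <= p.+1)%N,
    forall k, (0 < k <= p - l)%N -> c`_k = c0 k &
    (size (ga * gb + c * gd - ga * ge * gd)%R <= p.+1)%N].
  (* For [l = 0] also [m = 0], so [A], [D] and the defect are zero. *)
  have [l0|l0] := posnP l.
    have -> : gd = 0.
      apply/polyP => k; rewrite coef0 coef_genpoly; case: ifP => // /andP[k0 _].
      by rewrite /d l0 ifF //; lia.
    have -> : ga = 0.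
      apply/polyP => k; rewrite coef0 coef_genpoly; case: ifP => // /andP[k0 _].
      by rewrite /a ifF //; lia.
    exists gc0; split; first by rewrite coef_genpoly size_genpoly_leq.
      by move=> k kp; rewrite coef_genpoly ifT //; lia.
    by rewrite !mul0r mulr0 addr0 subr0 size_poly0.
  have sgd : size gd = l.+1.
    apply/eqP; rewrite eqn_leq sd ltnNge; apply/negP => /leq_sizeP/(_ l (leqnn _)).
    rewrite coef_genpoly l0 lelp /d leqnn => /eqP.
    by rewrite (gtn_eqF l0) in denv; rewrite (negPf denv).
  (* The product [A * E * D] has degree at most [m + (p - m) + l], and [A * B] at most [m + p] with
     [m <= l]. *)
  have sF : (size (ga * gb + gc0 * gd - ga * ge * gd)%R <= (p + l).+1)%N.
    apply: leq_trans (size_polyD _ _) _; rewrite size_polyN geq_max.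
    apply/andP; split; last first.
      by apply: (sM _ _ p l) => //; apply: (sM _ _ m (p - m)%N) => //; lia.
    apply: leq_trans (size_polyD _ _) _; rewrite geq_max; apply/andP; split.
      by apply: (sM _ _ m p) => //; lia.
    by apply: (sM _ _ (p - l)%N l) => //; lia.
  have [q sq sFq] := truncating_multiple lelp sgd sF.
  (* The correction starts in degree [p - l + 1], so the prescribed coefficients are kept; the bound
     on [q] keeps its degree at most [p]. *)
  exists (gc0 + 'X^((p - l).+1) * q); split.
  - split; first by rewrite coefD coefXnM coef_genpoly addr0.
    apply: leq_trans (size_polyD _ _) _; rewrite geq_max size_genpoly_leq /=.
    by apply: leq_trans (size_polyMleq _ _) _; rewrite size_polyXn; lia.
  - move=> k kp; rewrite coefD coefXnM coef_genpoly !ifT ?addr0 //; lia.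
  - by congr (size _ <= _)%N: sFq; congr polyseq; ring.
pose gc := fun k => c`_k.
have gcE : genpoly p gc = c by apply: genpoly_coef; case: c00.
pose def := ga * gb + c * gd - ga * ge * gd.
pose F i j k : K := match i, j with
  | 1, 3 => if sw then d k else a k
  | 3, 2 => if sw then a k else d k
  | 3, 1 => if sw then gc k else b k
  | 2, 3 => if sw then b k else gc k
  | 2, 1 => e k
  | 3, 3 => def`_k
  | _, _ => 0 end.
pose x : 'rV[K]_(9 * p) :=
  \row_j F (j %/ p %/ 3).+1%N (j %/ p %% 3).+1%N (j %% p).+1%N.
have xF i j k : (0 < i <= 3)%N -> (0 < j <= 3)%N -> (0 < k <= p)%N ->
    (X i j k).@[x ord0] = F i j k.
  by move=> i3 j3 kp; rewrite (@meval_row _ _ F) // => n; rewrite mxE.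
have xA k : (0 < k <= p)%N -> (A k).@[x ord0] = a k.
  by move=> kp; rewrite /cA; case: ifP => sw0; rewrite xF //= sw0.
have xB k : (0 < k <= p)%N -> (B k).@[x ord0] = b k.
  by move=> kp; rewrite /cB; case: ifP => sw0; rewrite xF //= sw0.
have xC k : (0 < k <= p)%N -> (C k).@[x ord0] = gc k.
  by move=> kp; rewrite /cC /cB if_neg; case: ifP => sw0; rewrite xF //= sw0.
have xD k : (0 < k <= p)%N -> (D k).@[x ord0] = d k.
  by move=> kp; rewrite /cD /cA if_neg; case: ifP => sw0; rewrite xF //= sw0.
have xE k : (0 < k <= p)%N -> (E k).@[x ord0] = e k by move=> kp; rewrite /cE xF.
have defE : defect false x = def.
  rewrite -(defect_swap sw) /defect /generating (eq_genpoly xA) (eq_genpoly xB).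
  by rewrite (eq_genpoly xC) (eq_genpoly xD) (eq_genpoly xE) gcE.
exists x.
  split; last split.
  - apply/G1P; rewrite defE; split=> // k kp; first by rewrite !xF.
    by rewrite xF.
  - by move=> k km; rewrite xA /a ?ifF //; lia.
  - by move=> k km; rewrite xE /e ?ifF //; lia.
  - by move=> k km; rewrite xD /d ?ifF //; lia.
  - move=> l0; rewrite xD ?l0 // /d leqnn.
    by rewrite (gtn_eqF l0) in denv.
move=> i; rewrite -(block_ord v) /params /stratum_params.
have p0 : (0 < p)%N by case: p i => [|//] [i]; rewrite muln0.
set k := (i %% p).+1%N; have kp : (0 < k <= p)%N by rewrite /k ltn_pmod.
have : (i %/ p < 3)%N by rewrite ltn_divLR.
case: (i %/ p)%N => [|[|[|//]]] _.
- case: leqP => km; last by rewrite xA // /a km.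
  by rewrite xE ?/e ?ifT ?subnKC //; lia.
- case: leqP => kl; last by rewrite xD // /d kl.
  by rewrite xC ?/gc ?cE ?/c0 ?ifT ?subnKC //; lia.
- by rewrite xB.
Qed.

Lemma stratum_graph : rational_graph S stratum_params stratum_den.
Proof.
split.
- exact: stratum_den_neq0.
- exact: stratum_surjective.
- exact: regular_coord.
(* The denominator is 1 or a single variable, so its value here is 1. *)
exists (fun=> 1); rewrite /stratum_den; case: (l == 0)%N.
  by rewrite meval1 oner_eq0.
by case: insubP => [i _ _|_]; rewrite ?meval1 ?mevalXU oner_eq0.
Qed.

End StratumParametrization.

(** * Equidimensionality from the finite cover by closures of strata *)

Theorem theorem4p27 (K : closedFieldType) (charK0 : [pchar K]%R =i pred0)
    (p : nat) (p_ge1 : 1 <= p) :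
  equidimensional (G1 K p) /\ has_dim (G1 K p) (3 * p).
Proof.
pose T : finType := (bool * 'I_p.+1 * 'I_p.+1)%type.
pose I := enum [pred i : T | i.1.2 <= i.2].
pose Z (i : T) := zariski_closure (@stratum K p i.1.1 i.1.2 i.2).
have memI i : (i \in I) = (i.1.2 <= i.2) by rewrite mem_enum.
(* The triple with [m = l = 0] shows that the family of strata is nonempty. *)
apply: (@equidimensional_cover _ _ _ _ (true, ord0, ord0) I Z).
- by rewrite memI.
- by move=> i; apply: zariski_closed_closure.
- move=> i; rewrite memI => lei; have lep : i.2 <= p by rewrite -ltnS.
  have graph := @stratum_graph K p i.1.1 _ _ lei lep; split.
  + exact: rational_graph_irreducible graph.
  + apply: zariski_closure_sub; last by move=> x [].
    by exists (@G1_equations K p).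
  + exact: rational_graph_dim graph.
move=> x /strata_cover[sw [m [l [/andP[leml lelp] Sx]]]].
have lemp := leq_trans leml lelp.
exists (sw, inord m, inord l); first by rewrite memI /= !inordK.
by apply: sub_zariski_closure; rewrite /= !inordK.
Qed.
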